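(* Let $(X,\mu)$ be a $\sigma$-finite measure space, let $S:L^1(X)\to L^1(X)$ be a semi-doubly stochastic operator, and let $F$ be a finite dimensional subspace of $L^1(X)$. Then there exists a sequence $(I_n)_{n\ge1}$ of semi-doubly stochastic integral operators on $L^1(X)$ which converges to $S$ on $F$, i.e. $\|I_nf-Sf\|_1\to0$ for every $f\in F$.
   Context: A semi-doubly stochastic operator is a positive linear operator $T:L^1(X)\to L^1(X)$ with $\int_X Tf\,d\mu=\int_X f\,d\mu$ for all $f\in L^1(X)$ and $\int_X T^*\chi_E\,d\mu\le\mu(E)$ for every measurable $E$ with $\mu(E)<\infty$, where $T^*:L^\infty(X)\to L^\infty(X)$ is the Banach adjoint. A semi-doubly stochastic kernel is a measurable function $K:X\times X\to[0,\infty)$ with $\int_X K(x,y)\,d\mu(x)=1$ for almost all $y$ and $\int_X K(x,y)\,d\mu(y)\le1$ for almost all $x$. A semi-doubly stochastic integral operator is an operator of the form $(If)(x)=\int_X K(x,y)f(y)\,d\mu(y)$ with $K$ a semi-doubly stochastic kernel. *)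

(* Defs.v *)
From HB Require Import structures.
From mathcomp Require Import all_boot all_order all_algebra.
From mathcomp Require Import all_classical all_reals all_analysis.
Set Implicit Arguments. Unset Strict Implicit. Unset Printing Implicit Defensive.
Import Order.TTheory GRing.Theory Num.Theory.
Local Open Scope classical_set_scope.
Local Open Scope ring_scope.

(* Elements of L^1(X) are represented by (real-valued) integrable functions;
   operators on L^1(X) by maps on functions that preserve integrability and
   respect equality almost everywhere. *)
Section defs.
Context {d : measure_display} {T : measurableType d} {R : realType}.
Variable mu : {measure set T -> \bar R}.

Definition L1fun (f : T -> R) : Prop := mu.-integrable setT (EFin \o f).

Definition positive_linear_op (S : (T -> R) -> (T -> R)) : Prop :=
  [/\ (forall f, L1fun f -> L1fun (S f)),
      (forall f g, L1fun f -> L1fun g -> {ae mu, forall x, f x = g x} ->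
          {ae mu, forall x, S f x = S g x}),
      (forall (a b : R) f g, L1fun f -> L1fun g ->
          {ae mu, forall x, S (fun y => a * f y + b * g y) x = a * S f x + b * S g x}) &
      (forall f, L1fun f -> {ae mu, forall x, 0 <= f x} ->
          {ae mu, forall x, 0 <= S f x})].

(* h (an element of L^\infty) is the Banach adjoint S^* applied to the
   indicator of E :  \int (S^* chi_E) f = \int chi_E (S f) for all f in L^1 *)
Definition adjoint_of_indicator (S : (T -> R) -> (T -> R)) (E : set T)
    (h : T -> R) : Prop :=
  [/\ measurable_fun setT h,
      (exists M : R, {ae mu, forall x, `|h x| <= M}) &
      (forall f, L1fun f ->
         (\int[mu]_x (h x * f x)%:E = \int[mu]_x ((\1_E x : R) * S f x)%:E)%E)].

Definition semi_doubly_stochastic_op (S : (T -> R) -> (T -> R)) : Prop :=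
  [/\ positive_linear_op S,
      (forall f, L1fun f -> (\int[mu]_x (S f x)%:E = \int[mu]_x (f x)%:E)%E) &
      (forall E, measurable E -> (mu E < +oo)%E ->
         forall h, adjoint_of_indicator S E h ->
           (\int[mu]_x (h x)%:E <= mu E)%E)].

Definition semi_doubly_stochastic_kernel (K : T -> T -> R) : Prop :=
  [/\ measurable_fun setT (fun p : T * T => K p.1 p.2),
      (forall x y, 0 <= K x y),
      {ae mu, forall y, (\int[mu]_x (K x y)%:E = 1)%E} &
      {ae mu, forall x, (\int[mu]_y (K x y)%:E <= 1)%E}].

Definition integral_op (K : T -> T -> R) (f : T -> R) : T -> R :=
  fun x => Rintegral mu setT (fun y => K x y * f y).

End defs.

(* Main.v *)
Require Import Defs.
From HB Require Import structures.
From mathcomp Require Import all_boot all_order all_algebra.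
From mathcomp Require Import all_classical all_reals all_analysis.
From mathcomp Require Import measurable_realfun lra ring.
Import Order.TTheory GRing.Theory Num.Theory.
Import numFieldNormedType.Exports HBNNSimple.
Local Open Scope classical_set_scope.
Local Open Scope ring_scope.

(** For a countable partition of X into cells P_j of finite measure, let E be
    the conditional expectation onto cell-wise constant functions. Then E S E is
    an integral operator: its kernel is constant on P_l x P_j, with value
    (int_{P_l} S 1_{P_j}) / (mu(P_l) mu(P_j)). Mass preservation of S gives the
    column condition, and int S^* 1_{P_l} <= mu(P_l) gives the row condition,
    where S^* 1_{P_l} is obtained from Radon-Nikodym. Since S is an L^1
    contraction, E S E is close to S on f as soon as f and S f are L^1-close to
    cell-wise constant functions, and a partition achieving this for finitely
    many functions at once is cut out by their level sets, with a mesh small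
    compared with the measure of the sigma-finite piece at hand. *)

Set Implicit Arguments.
Unset Strict Implicit.

(** * Functionals on L^1 *)

Section L1.
Context {d : measure_display} {T : measurableType d} {R : realType}.
Variable mu : {measure set T -> \bar R}.
Implicit Types (f g h : T -> R) (A : set T).

Lemma L1fun_measurable f : L1fun mu f -> measurable_fun setT f.
Proof. by move/measurable_int/measurable_EFinP. Qed.

Lemma L1fun_integrableS f A : measurable A -> L1fun mu f ->
  mu.-integrable A (EFin \o f).
Proof. by move=> mA; exact: integrableS. Qed.

Lemma eq_L1fun f g : f =1 g -> L1fun mu f -> L1fun mu g.
Proof. by move=> /funext ->. Qed.

Lemma L1fun_le f g : measurable_fun setT f -> (forall x, `|f x| <= g x) ->
  L1fun mu g -> L1fun mu f.
Proof.
move=> mf fg; apply: le_integrable => //; first exact/measurable_EFinP.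
by move=> x _ /=; rewrite lee_fin (le_trans (fg x))// ler_norm.
Qed.

Lemma L1fun_lin (a b : R) f g : L1fun mu f -> L1fun mu g ->
  L1fun mu (fun x => a * f x + b * g x).
Proof.
move=> lf lg; have := integrableD measurableT (integrableZl measurableT a lf)
  (integrableZl measurableT b lg).
by apply: eq_integrable.
Qed.

Lemma L1fun_norm f : L1fun mu f -> L1fun mu (fun x => `|f x|).
Proof. exact: integrable_norm. Qed.

Lemma L1fun_sub f g : L1fun mu f -> L1fun mu g -> L1fun mu (fun x => f x - g x).
Proof.
by move=> lf lg; have := integrableB measurableT lf lg; apply: eq_integrable.
Qed.

Lemma L1fun_boundedM f g (M : R) : measurable_fun setT f ->
  (forall x, `|f x| <= M) -> L1fun mu g -> L1fun mu (fun x => f x * g x).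
Proof.
move=> mf fM lg; apply: (@L1fun_le _ (fun x => M * `|g x| + 0 * g x)).
- exact/measurable_funM/L1fun_measurable.
- by move=> x; rewrite mul0r addr0 normrM ler_wpM2r.
- exact/L1fun_lin/lg/L1fun_norm.
Qed.

Lemma L1fun_indicM f A : measurable A -> L1fun mu f ->
  L1fun mu (fun x => \1_A x * f x).
Proof.
move=> mA; apply: (@L1fun_boundedM _ _ 1); first exact: measurable_indic.
by move=> x; rewrite ger0_norm// indicE lern1 leq_b1.
Qed.

Lemma Rintegral_indicM f A :
  \int[mu]_x (\1_A x * f x) = \int[mu]_(x in A) f x.
Proof.
rewrite [RHS]Rintegral_mkcond; apply: eq_Rintegral => x _.
by rewrite patch_indic/= mulrC.
Qed.

Lemma L1fun0 : L1fun mu (fun=> 0).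
Proof. exact: integrable0. Qed.

Lemma L1fun_sum (n : nat) (c : 'I_n -> R) (f : 'I_n -> T -> R) :
  (forall i, L1fun mu (f i)) -> L1fun mu (fun x => \sum_(i < n) c i * f i x).
Proof.
elim: n c f => [|n ih] c f lf.
  by apply: eq_L1fun L1fun0 => x; rewrite big_ord0.
have := L1fun_lin 1 (c ord_max) (ih (c \o widen_ord (leqnSn n)) _
  (fun i => lf (widen_ord (leqnSn n) i))) (lf ord_max).
by apply: eq_L1fun => x /=; rewrite big_ord_recr/= mul1r.
Qed.

(** Testing on A = {g < f} makes the integral of f - g over A both nonnegative and nonpositive, so f
    - g vanishes almost everywhere on A, and A is null. *)
Lemma ae_le_of_integrals f g : L1fun mu f -> L1fun mu g ->
  (forall A, measurable A ->
    \int[mu]_(x in A) f x <= \int[mu]_(x in A) g x) ->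
  {ae mu, forall x, f x <= g x}.
Proof.
move=> lf lg fg.
have mf := L1fun_measurable lf; have mg := L1fun_measurable lg.
pose A := [set x | g x < f x].
have mA : measurable A.
  rewrite -[A]setTI; have := measurable_fun_ltr mg mf.
  by move=> /(_ measurableT [set true] Logic.I).
have := fg A mA; rewrite -subr_le0 -RintegralB//; [|exact: L1fun_integrableS..].
have iA := L1fun_integrableS mA (L1fun_sub lf lg).
move=> le0.
have : (\int[mu]_(x in A) `|(f x - g x)%:E| = 0)%E.
  rewrite (eq_integral (EFin \o (fun x => f x - g x))); last first.
    by move=> x; rewrite inE /A/= => gf; rewrite ger0_norm// subr_ge0 ltW.
  have := integrable_fin_num mA iA; move/fineK => <-.
  congr EFin; apply/eqP; rewrite eq_le le0/=.
  by apply: Rintegral_ge0 => x; rewrite /A/= => gf; rewrite subr_ge0 ltW.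
move/ae_eq_integral_abs => /(_ mA (measurable_int _ iA)).
apply: filterS => x /= h; rewrite leNgt; apply/negP => gf.
have [/eqP] := h gf; rewrite subr_eq0 => /eqP fgx.
by move: gf; rewrite fgx ltxx.
Qed.

(** The model case is f |-> int_E S f. Domination by the integral gives |Phi f| <= int |f|, hence
    invariance under almost everywhere equality, and later a density with values in [0, 1]. *)
Definition dominated_functional (Phi : (T -> R) -> R) : Prop :=
  (forall (a b : R) f g, L1fun mu f -> L1fun mu g ->
    Phi (fun x => a * f x + b * g x) = a * Phi f + b * Phi g) /\
  (forall f, L1fun mu f -> (forall x, 0 <= f x) ->
    0 <= Phi f <= \int[mu]_x f x).

Section functional.
Variable Phi : (T -> R) -> R.
Hypothesis domPhi : dominated_functional Phi.

Lemma functionalB f g : L1fun mu f -> L1fun mu g ->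
  Phi (fun x => f x - g x) = Phi f - Phi g.
Proof.
move=> lf lg; have := domPhi.1 1 (-1) _ _ lf lg; rewrite mul1r mulN1r => <-.
by congr Phi; apply/funext => x; rewrite mul1r mulN1r.
Qed.

Lemma functional0 : Phi (fun=> 0) = 0.
Proof.
by have := functionalB L1fun0 L1fun0; rewrite !subrr.
Qed.

Lemma functional_le f g : L1fun mu f -> L1fun mu g ->
  (forall x, f x <= g x) -> Phi f <= Phi g.
Proof.
move=> lf lg fg; rewrite -subr_ge0 -functionalB//.
have gf x : 0 <= g x - f x by rewrite subr_ge0.
by case/andP: (domPhi.2 _ (L1fun_sub lg lf) gf).
Qed.

Lemma functional_norm_le f : L1fun mu f -> `|Phi f| <= \int[mu]_x `|f x|.
Proof.
move=> lf; have lnf := L1fun_norm lf.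
have /andP[_ le] := domPhi.2 _ lnf (fun x => normr_ge0 _).
rewrite (le_trans _ le)// ler_norml functional_le// ?andbT; last first.
  by move=> x; exact: ler_norm.
rewrite lerNl -[X in X <= _]add0r -functional0 -functionalB//; last exact: L1fun0.
apply: functional_le => //; first exact: L1fun_sub L1fun0 lf.
by move=> x; rewrite sub0r -normrN ler_norm.
Qed.

Lemma functional_sum (n : nat) (c : 'I_n -> R) (F : 'I_n -> T -> R) :
  (forall i, L1fun mu (F i)) ->
  Phi (fun x => \sum_(i < n) c i * F i x) = \sum_(i < n) c i * Phi (F i).
Proof.
elim: n c F => [|n ih] c F lF.
  rewrite big_ord0 -[RHS]functional0; congr Phi.
  by apply/funext => x; rewrite big_ord0.
rewrite big_ord_recr /= -[X in X + _]ih// -[X in X + _]mul1r -domPhi.1//.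
  by congr Phi; apply/funext => x; rewrite big_ord_recr /= mul1r.
exact: (@L1fun_sum _ (fun i => c (widen_ord (leqnSn n) i))
  (fun i => F (widen_ord (leqnSn n) i))).
Qed.

(** By the norm bound it suffices that int |F n - f| tends to 0, which is dominated convergence. *)
Lemma functional_dominated_cvg (F : nat -> T -> R) f g :
  (forall n, measurable_fun setT (F n)) -> measurable_fun setT f ->
  (forall x, F n x @[n --> \oo] --> f x) ->
  (forall n x, `|F n x| <= g x) -> L1fun mu g ->
  Phi (F n) @[n --> \oo] --> Phi f.
Proof.
move=> mF mf Ff Fg lg.
have lF n : L1fun mu (F n) by apply: L1fun_le (Fg n) lg.
have Ffe : {ae mu, forall x, setT x ->
    (EFin \o F ^~ x) n @[n --> \oo] --> (EFin \o f) x}.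
  by apply: aeW => x _; apply: cvg_EFin; [exact: nearW|exact: Ff].
have Fge : {ae mu, forall x n, setT x -> (`|(EFin \o F n) x| <= (EFin \o g) x)%E}.
  by apply: aeW => x n _; rewrite /= lee_fin.
have [lf h _] := dominated_convergence measurableT
  (fun n => iffRL (measurable_EFinP _ _) (mF n))
  (iffRL (measurable_EFinP _ _) mf) Ffe lg Fge.
apply/subr_cvg0/norm_cvg0P.
apply: (@squeeze_cvgr _ _ _ _ (fun=> 0) (fun n => \int[mu]_x `|F n x - f x|)); last 2 first.
- exact: cvg_cst.
- exact: (fine_cvg h).
apply: nearW => n; rewrite normr_ge0/= -functionalB//.
exact/functional_norm_le/L1fun_sub.
Qed.

End functional.
End L1.

Lemma measurable_fun_inv_gt0 {d : measure_display} {T : measurableType d}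
    {R : realType} (f : T -> R) :
  measurable_fun setT f -> (forall x, 0 < f x) ->
  measurable_fun setT (fun x => (f x)^-1).
Proof.
move=> mf f0; have -> : (fun x => (f x)^-1) = (@powR R ^~ (-1)) \o f.
  by apply/funext => x; rewrite /= powR_inv1// ltW.
by apply: measurableT_comp => //; exact: measurable_powR.
Qed.

Section functional_ext.
Context {d : measure_display} {T : measurableType d} {R : realType}.
Variable mu : {measure set T -> \bar R}.

(** The functions 1_A w are rich enough: f / w is a limit of simple functions from below, and
    multiplying these by w gives combinations of such functions, dominated by f and converging to
    f. *)
Lemma functional_ext (Phi Psi : (T -> R) -> R) (w f : T -> R) :
  dominated_functional mu Phi -> dominated_functional mu Psi ->
  (forall x, 0 < w x) -> L1fun mu w ->
  (forall A, measurable A ->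
    Phi (fun x => \1_A x * w x) = Psi (fun x => \1_A x * w x)) ->
  L1fun mu f -> Phi f = Psi f.
Proof.
move=> dPhi dPsi w0 lw PhiPsi.
have mw := L1fun_measurable lw.
wlog : f / forall x, 0 <= f x => [h lf|f0 lf].
  (* Both |f| and |f| - f are nonnegative and integrable. *)
  have fE : f = (fun x => `|f x| - (`|f x| - f x)) by apply/funext => x; lra.
  have lnf := L1fun_norm lf; have lnf' := L1fun_sub lnf lf.
  rewrite fE (functionalB dPhi)// (functionalB dPsi)//.
  by rewrite !h// => x; rewrite subr_ge0 ler_norm.
have mf := L1fun_measurable lf.
have mfw : measurable_fun setT (EFin \o (fun x => f x / w x)).
  apply/measurable_EFinP; apply: measurable_funM => //.
  exact: measurable_fun_inv_gt0.
pose F n x := nnsfun_approx measurableT mfw n x * w x.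
have fw0 x : setT x -> (0 <= (f x / w x)%:E)%E.
  by move=> _; rewrite /= lee_fin divr_ge0// ltW.
have Fle n x : F n x <= f x.
  rewrite -ler_pdivlMr// -lee_fin nnsfun_approxE.
  exact: (le_approx _ fw0).
have PhiF n : Phi (F n) = Psi (F n).
  have [N [a [A [mA phiE]]]] : exists N (a : 'I_N -> R) (A : 'I_N -> set T),
      (forall i, measurable (A i)) /\
      forall x, nnsfun_approx measurableT mfw n x = \sum_(i < N) a i * \1_(A i) x.
    do 3 eexists; split; last by move=> x; rewrite fimfunEord; reflexivity.
    by move=> i /=.
  have -> : F n = (fun x => \sum_(i < N) a i * (\1_(A i) x * w x)).
    apply/funext => x; rewrite /F phiE mulr_suml.
    by apply: eq_bigr => i _; rewrite mulrA.
  rewrite (functional_sum dPhi) ?(functional_sum dPsi)//.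
  - by apply: eq_bigr => i _; rewrite PhiPsi.
  - by move=> i; exact: L1fun_indicM.
  - by move=> i; exact: L1fun_indicM.
have cv Xi : dominated_functional mu Xi -> Xi (F n) @[n --> \oo] --> Xi f.
  move=> dXi; apply: (functional_dominated_cvg dXi _ _ _ _ lf) => //.
  - by move=> n; exact: measurable_funM.
  - move=> x; rewrite -[f x](divfK (lt0r_neq0 (w0 x))).
    apply: cvgM; last exact: cvg_cst.
    by have /fine_cvg := cvg_nnsfun_approx measurableT mfw fw0 (x := x) Logic.I.
  - by move=> n x; rewrite ger0_norm// mulr_ge0// ltW.
have := cv _ dPhi.
rewrite (_ : (fun n => Phi (F n)) = (fun n => Psi (F n))); last exact/funext.
by move=> /(cvg_unique _)/(_ (cv _ dPsi)) => ->.
Qed.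

End functional_ext.

(* [Phi 1_A] makes no sense when [mu A] is infinite, so Radon-Nikodym is applied
   to [A |-> Phi (1_A w)] for an integrable weight [w > 0], and the density is
   divided by [w]. *)
Section riesz.
Context {d : measure_display} {T : measurableType d} {R : realType}.
Variable mu : {measure set T -> \bar R}.
Hypothesis hmu : sigma_finite setT mu.
Variable Phi : (T -> R) -> R.
Hypothesis domPhi : dominated_functional mu Phi.
Variable w : T -> R.
Hypotheses (w_gt0 : forall x, 0 < w x) (lw : L1fun mu w).
Implicit Types (f g h : T -> R) (A : set T).

Let mw : measurable_fun setT w := L1fun_measurable lw.

Definition weighted_charge A : \bar R := (Phi (fun x => \1_A x * w x))%:E.

Lemma weighted_charge0 : weighted_charge set0 = 0%E.
Proof.
rewrite /weighted_charge -[0%E]/(0%:E) -(functional0 domPhi); congr (Phi _)%:E.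
by apply/funext => x; rewrite indic0 mul0r.
Qed.

(** The partial sums of 1_(A i) w converge pointwise to the weighted indicator of the union and are
    dominated by w. *)
Lemma weighted_charge_additive : semi_sigma_additive weighted_charge.
Proof.
move=> A mA tA mUA; rewrite /weighted_charge.
pose F n x := \sum_(i < n) (1 * (\1_(A i) x * w x)).
have FE n x : F n x = (\sum_(0 <= i < n) \1_(A i) x) * w x.
  rewrite big_mkord mulr_suml; apply: eq_bigr => i _; exact: mul1r.
have -> : (fun n => \sum_(0 <= i < n) (Phi (fun x => \1_(A i) x * w x))%:E)%E =
    (fun n => (Phi (F n))%:E).
  apply/funext => n; rewrite big_mkord sumEFin; congr EFin.
  rewrite (functional_sum domPhi); last by move=> i; exact: L1fun_indicM.
  by apply: eq_bigr => i _; rewrite mul1r.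
apply: cvg_EFin; first exact: nearW.
have sumE x : (\sum_(0 <= i < n) (\1_(A i) x)%:E)%E @[n --> \oo] -->
    (\1_(\bigcup_n A n) x : R)%:E.
  rewrite indic_bigcup//; apply: is_cvg_nneseries => n _ _.
  by rewrite lee_fin.
apply: (functional_dominated_cvg domPhi _ _ _ _ lw).
- move=> n; apply: measurable_sum => i; apply: measurable_funM => //.
  by apply: measurable_funM => //; exact: measurable_indic.
- by apply: measurable_funM => //; exact: measurable_indic.
- move=> x; under eq_fun do rewrite FE.
  apply: cvgM; last exact: cvg_cst.
  have -> : (fun n => \sum_(0 <= i < n) \1_(A i) x : R) =
      fine \o (fun n => (\sum_(0 <= i < n) (\1_(A i) x)%:E)%E).
    by apply/funext => n /=; rewrite sumEFin.
  exact: fine_cvg (sumE x).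
- move=> n x; rewrite FE ger0_norm; last first.
    by apply: mulr_ge0; [exact: sumr_ge0|exact: ltW].
  apply: ler_piMl; first exact: ltW.
  rewrite -lee_fin -sumEFin.
  apply: (@le_trans _ _ (\1_(\bigcup_n A n) x : R)%:E); last first.
    by rewrite lee_fin indicE lern1 leq_b1.
  rewrite indic_bigcup//; apply: nneseries_lim_ge => i _.
  by rewrite lee_fin.
Qed.

HB.instance Definition _ := isCharge.Build _ _ _ weighted_charge
  weighted_charge0 (fun _ _ => isT) weighted_charge_additive.

Lemma weighted_charge_dominated : weighted_charge `<< mu.
Proof.
apply/null_content_dominatesP => A mA A0; congr EFin.
apply/eqP; rewrite -normr_eq0 eq_le normr_ge0 andbT.
have l1 := L1fun_indicM mA lw.
apply: (le_trans (functional_norm_le domPhi l1)).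
rewrite (@eq_Rintegral _ _ _ _ _ (fun x => \1_A x * w x)); last first.
  by move=> x _; rewrite ger0_norm// mulr_ge0// ltW.
rewrite Rintegral_indicM /Rintegral null_set_integral//.
exact/measurable_EFinP/(measurable_funS measurableT).
Qed.


Lemma riesz : exists h, [/\ measurable_fun setT h, forall x, 0 <= h x <= 1 &
  forall f, L1fun mu f -> Phi f = \int[mu]_x (h x * f x)].
Proof.
(* Radon-Nikodym expects a bundled sigma-finite measure, so [hmu] is packed together with [mu]. *)
pose mu' : {sigma_finite_measure set T -> \bar R} :=
  HB.pack (mu : set T -> \bar R) (Measure.class mu)
    (isSFinite.Build _ _ _ mu (sfinite_measure_sigma_finite hmu))
    (isSigmaFinite.Build _ _ _ mu hmu).
have numu : weighted_charge `<< mu' := weighted_charge_dominated.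
pose r x := fine (Radon_Nikodym weighted_charge mu' x).
have rE : EFin \o r = Radon_Nikodym weighted_charge mu'.
  by apply/funext => x; rewrite /= fineK//; exact: Radon_Nikodym_fin_num.
have lr : L1fun mu r by rewrite /L1fun rE; exact: (Radon_Nikodym_integrable numu).
have rA A : measurable A -> \int[mu]_(x in A) r x = Phi (fun x => \1_A x * w x).
  move=> mA; have := Radon_Nikodym_integral numu mA; rewrite -rE.
  by rewrite /Rintegral => <-.
have w1_ge0 A x : 0 <= \1_A x * w x by rewrite mulr_ge0// ltW.
have r_ge0 : {ae mu, forall x, 0 <= r x}.
  apply: ae_le_of_integrals (L1fun0 mu) lr _ => A mA.
  rewrite rA// [X in X <= _]Rintegral_cst// mul0r.
  by case/andP: (domPhi.2 _ (L1fun_indicM mA lw) (w1_ge0 A)).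
have r_lew : {ae mu, forall x, r x <= w x}.
  apply: ae_le_of_integrals lr lw _ => A mA.
  rewrite rA// -Rintegral_indicM.
  by case/andP: (domPhi.2 _ (L1fun_indicM mA lw) (w1_ge0 A)).
(* The bounds 0 <= r <= w hold only almost everywhere; clamping r / w to [0, 1] makes those on [h]
   hold everywhere and keeps h w = r almost everywhere. *)
pose h x := Num.max 0 (Num.min 1 (r x / w x)).
have h01 x : 0 <= h x <= 1 by rewrite /h le_max lexx/= ge_max ler01/= ge_min lexx.
have mr := L1fun_measurable lr.
have mh : measurable_fun setT h.
  apply: measurable_maxr => //; apply: measurable_minr => //.
  by apply: measurable_funM => //; exact: measurable_fun_inv_gt0.
have hwr : {ae mu, forall x, h x * w x = r x}.
  apply: filterS2 r_ge0 r_lew => x r0 rw.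
  rewrite /h min_r ?max_r ?divfK ?lt0r_neq0//.
    by rewrite divr_ge0// ltW.
  by rewrite ler_pdivrMr// mul1r.
exists h; split => // f lf.
have hb x : `|h x| <= 1 by case/andP: (h01 x) => h0 h1; rewrite ger0_norm.
have lh g : L1fun mu g -> L1fun mu (fun x => h x * g x) by exact: L1fun_boundedM.
(* The functional f |-> int h f is dominated as well, and agrees with [Phi] on every 1_A w. *)
apply: (@functional_ext _ _ _ mu Phi (fun f => \int[mu]_x (h x * f x)) w f
  domPhi _ w_gt0 lw _ lf).
  split => [a b f1 f2 l1 l2|f1 l1 f1_ge0].
    rewrite -RintegralZl ?lh// -RintegralZl ?lh// -RintegralD//; first last.
    - exact: (integrableZl measurableT b (lh _ l2)).
    - exact: (integrableZl measurableT a (lh _ l1)).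
    by apply: eq_Rintegral => x _; lra.
  apply/andP; split.
    by apply: Rintegral_ge0 => x _; rewrite mulr_ge0//; case/andP: (h01 x).
  apply: le_Rintegral => //; first exact: lh.
  by move=> x _; rewrite ler_piMl//; case/andP: (h01 x).
move=> A mA; rewrite -rA// -Rintegral_indicM /Rintegral; congr fine.
apply: ae_eq_integral => //.
- exact/measurable_EFinP/L1fun_measurable/(L1fun_indicM mA lr).
- exact/measurable_EFinP/L1fun_measurable/(lh _ (L1fun_indicM mA lw)).
apply: filterS hwr => x hwrx _; rewrite -hwrx; congr EFin; lra.
Qed.

End riesz.

(** * Countable measurable partitions *)

Section cells.
Context {d : measure_display} {T : measurableType d} {R : realType}.
Variable mu : {measure set T -> \bar R}.

Lemma measurable_fun_fibers (c : T -> nat) :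
  (forall j, measurable (c @^-1` [set j])) -> measurable_fun setT c.
Proof.
move=> mc _ Y _; rewrite setTI.
rewrite (_ : c @^-1` Y = \bigcup_(j in Y) c @^-1` [set j]).
  exact: bigcup_measurable.
by apply/seteqP; split => [x Yx|x [j Yj /= ->]//]; exists (c x).
Qed.

Section decomposition.
Variable c : T -> nat.
Hypothesis mc : measurable_fun setT c.

Lemma measurable_fiber j : measurable (c @^-1` [set j]).
Proof. by rewrite -[X in measurable X]setTI; exact: mc. Qed.

Lemma measurable_fun_fiberwise {d' : measure_display} {U : measurableType d'}
  (a : nat -> U) : measurable_fun setT (fun x => a (c x)).
Proof. by apply: (@measurableT_comp _ _ _ _ _ _ a) => //. Qed.

Lemma bigcup_fibers : \bigcup_j (c @^-1` [set j]) = setT.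
Proof. by apply/seteqP; split => // x _; exists (c x). Qed.

Lemma trivIset_fibers : trivIset setT (fun j => c @^-1` [set j]).
Proof. by move=> i j _ _ [x [/= <- <-]]. Qed.

Lemma ge0_integral_fibers (f : T -> \bar R) : measurable_fun setT f ->
  (forall x, 0 <= f x)%E ->
  (\int[mu]_x f x = \sum_(j <oo) \int[mu]_(x in c @^-1` [set j]) f x)%E.
Proof.
move=> mf f0; rewrite -[in LHS]bigcup_fibers ge0_integral_bigcup//.
- exact: measurable_fiber.
- by rewrite bigcup_fibers.
- exact: trivIset_fibers.
Qed.

Lemma integral_fibers (f : T -> \bar R) : mu.-integrable setT f ->
  (\int[mu]_x f x = \sum_(j <oo) \int[mu]_(x in c @^-1` [set j]) f x)%E.
Proof.
move=> fi; rewrite -[in LHS]bigcup_fibers integral_bigcup//.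
- exact: trivIset_fibers.
- exact: measurable_fiber.
- by rewrite bigcup_fibers.
Qed.

End decomposition.

(* Cut the pieces [D_n] of a sigma-finite decomposition into cubes of side
   [eps 2^-(n+1) / (1 + mu D_n)] in the coordinates [h_i]. *)
Lemma fine_partition (N : nat) (h : 'I_N -> T -> R) (eps : R) :
  sigma_finite setT mu -> (forall i, measurable_fun setT (h i)) -> 0 < eps ->
  exists (c : T -> nat) (e : nat -> R),
  [/\ measurable_fun setT c, forall j, 0 < e j,
      forall j, (mu (c @^-1` [set j]) < +oo)%E,
      (\int[mu]_x (e (c x))%:E <= eps%:E)%E &
      forall i, exists a : nat -> R, forall x, `|h i x - a (c x)| <= e (c x)].
Proof.
move=> [F FT /all_and2[mF Foo]] mh eps0.
have mD n : measurable (seqDU F n) := seqDU_measurable mF n.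
have /choice[k kD] : forall x, exists n, seqDU F n x.
  move=> x; have : setT x by []; rewrite FT seqDU_bigcup_eq.
  by move=> [n _ Dnx]; exists n.
have kE n : k @^-1` [set n] = seqDU F n.
  apply/seteqP; split => [x /= <-//|x Dx /=].
  by apply: (trivIset_seqDU F) => //; exists x; split.
have mk : measurable_fun setT k by apply: measurable_fun_fibers => n; rewrite kE.
have Doo n : (mu (seqDU F n) < +oo)%E.
  apply: (le_lt_trans _ (Foo n)); apply: le_measure.
  - exact/mem_set.
  - exact/mem_set.
  - exact: (@subset_seqDU _ F n).
pose dl n : R := eps / (2 ^ n.+1)%:R / (1 + fine (mu (seqDU F n))).
have dn n : 0 < 1 + fine (mu (seqDU F n)) by rewrite ltr_wpDr// fine_ge0.
have dl0 n : 0 < dl n.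
  by rewrite /dl !divr_gt0// ltr0n expn_gt0.
(* A cell is named by its piece and the integer coordinates of its cube; these data are countable,
   so [pickle] turns them into a natural number. *)
pose code x : nat * {ffun 'I_N -> int} :=
  (k x, [ffun i => Num.floor (h i x / dl (k x))]).
pose c x := pickle (code x).
(* The side length is read back from the code; the default 1 only keeps [e] positive on numbers that
   encode nothing. *)
pose e j := if @unpickle (nat * {ffun 'I_N -> int})%type j is Some p
  then dl p.1 else 1.
have eE x : e (c x) = dl (k x) by rewrite /e /c pickleK.
have cD x y : c x = c y -> code x = code y by exact: (pcan_inj pickleK).
have mc : measurable_fun setT c.
  apply: measurable_fun_fibers => j.
  have [->|/set0P[x0 /= <-]] := eqVneq (c @^-1` [set j]) set0 => //.
  (* The fiber through x0 consists of the points of the same piece whose scaled coordinates have the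
     same integer parts. *)
  rewrite (_ : _ @^-1` _ = seqDU F (k x0) `&` \bigcap_(i in setT)
    (fun x => h i x / dl (k x0)) @^-1`
     `[(Num.floor (h i x0 / dl (k x0)))%:~R,
       (Num.floor (h i x0 / dl (k x0)) + 1)%:~R[).
    apply: measurableI => //; apply: fin_bigcap_measurable => // i _.
    rewrite -[X in measurable X]setTI.
    by apply: measurable_funM.
  rewrite -kE; apply/seteqP; split => [x /= /cD[kx /ffunP hx]|x [/= kx hx]].
    split => // i _ /=; have := hx i; rewrite !ffunE kx => <-.
    by rewrite in_itv/=; exact: floor_itv.
  congr pickle; rewrite /code kx; congr pair; apply/ffunP => i; rewrite !ffunE.
  by apply: floor_def; have := hx i Logic.I; rewrite /= in_itv.
exists c, e; split => //.
- by move=> j; rewrite /e; case: unpickle.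
- move=> j; have [->|/set0P[x0 /= <-]] := eqVneq (c @^-1` [set j]) set0.
    by rewrite measure0.
  apply: le_lt_trans (Doo (k x0)); apply: le_measure.
  + exact/mem_set/measurable_fiber.
  + exact/mem_set.
  + by rewrite -kE => x /= /cD[].
- under eq_integral do rewrite eE.
  rewrite (ge0_integral_fibers mk); last 2 first.
  + exact/measurable_EFinP/measurable_fun_fiberwise.
  + by move=> x; rewrite lee_fin ltW.
  apply: le_trans (epsilon_trick0 xpredT (ltW eps0)).
  apply: lee_nneseries => [n _ _|n _].
    by apply: integral_ge0 => x _; rewrite lee_fin ltW.
  rewrite kE (eq_integral (cst (dl n)%:E)); last first.
    by move=> x; rewrite inE -kE => /= ->.
  rewrite integral_cst// -[mu _]fineK ?ge0_fin_numE// -EFinM lee_fin.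
  (* As mu D_n / (1 + mu D_n) <= 1, the piece D_n contributes at most eps / 2^(n+1). *)
  by rewrite /dl mulrAC ler_pdivrMr// ler_wpM2l ?divr_ge0 ?(ltW eps0)// lerDr.
(* The approximating value on a cell is the lower endpoint of its cube in coordinate i. *)
- move=> i; exists (fun j => if @unpickle (nat * {ffun 'I_N -> int})%type j is Some p
    then dl p.1 * (p.2 i)%:~R else 0) => x.
  rewrite eE /c pickleK/= ffunE.
  have /andP[h1 h2] := floor_itv (h i x / dl (k x)).
  rewrite ler_norml; move: h1 h2; rewrite intrD.
  rewrite ler_pdivlMr// ltr_pdivrMr// => h1 h2.
  by apply/andP; split; have := dl0 (k x); lra.
Qed.

End cells.

(** * Adjoints of indicators *)

Section operator.
Context {d : measure_display} {T : measurableType d} {R : realType}.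
Variable mu : {measure set T -> \bar R}.
Variable S : (T -> R) -> (T -> R).
Hypothesis hS : semi_doubly_stochastic_op mu S.
Implicit Types f g : T -> R.

Lemma ae_eq_Rintegral f g (A : set T) : measurable A ->
  measurable_fun setT f -> measurable_fun setT g ->
  {ae mu, forall x, f x = g x} ->
  \int[mu]_(x in A) f x = \int[mu]_(x in A) g x.
Proof.
move=> mA mf mg fg; congr fine; apply: ae_eq_integral => //.
- exact/measurable_EFinP/(measurable_funS measurableT).
- exact/measurable_EFinP/(measurable_funS measurableT).
- by apply: filterS fg => x /= -> _.
Qed.

Lemma EFin_Rintegral f (A : set T) : measurable A -> L1fun mu f ->
  ((\int[mu]_(x in A) f x)%R%:E = \int[mu]_(x in A) (f x)%:E)%E.
Proof.
by move=> mA lf; rewrite fineK// (integrable_fin_num mA)//; exact: L1fun_integrableS.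
Qed.

Lemma op_L1fun f : L1fun mu f -> L1fun mu (S f).
Proof. by move=> lf; case: hS => -[+ _ _ _] _ _; exact. Qed.

Lemma op_Rintegral f : L1fun mu f -> \int[mu]_x S f x = \int[mu]_x f x.
Proof. by move=> lf; case: hS => _ + _ => /(_ f lf) h; congr fine. Qed.

Lemma op_ge0 f : L1fun mu f -> (forall x, 0 <= f x) ->
  {ae mu, forall x, `|S f x| = S f x}.
Proof.
move=> lf f0; case: hS => -[_ _ _ +] _ _ => /(_ f lf (aeW mu f0)).
by apply: filterS => x ?; rewrite ger0_norm.
Qed.

Lemma op_sum (n : nat) (a : 'I_n -> R) (F : 'I_n -> T -> R) :
  (forall i, L1fun mu (F i)) ->
  {ae mu, forall x, S (fun x => \sum_(i < n) a i * F i x) x =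
                    \sum_(i < n) a i * S (F i) x}.
Proof.
have [[_ _ lin _] _ _] := hS.
elim: n a F => [|n ih] a F lF.
  (* The zero function is a linear combination with zero coefficients, so linearity gives S 0 = 0
     almost everywhere. *)
  have := lin 0 0 _ _ (L1fun0 mu) (L1fun0 mu).
  apply: filterS => x Sx; rewrite big_ord0; move: Sx.
  rewrite [RHS](_ : _ = 0); last by rewrite !mul0r addr0.
  move=> Sx; rewrite -[RHS]Sx; congr (S _ x); apply/funext => y.
  by rewrite big_ord0 !mul0r addr0.
pose v := widen_ord (leqnSn n).
have lsum := L1fun_sum (fun i => a (v i)) (fun i => lF (v i)).
apply: filterS2 (ih (fun i => a (v i)) _ (fun i => lF (v i)))
   (lin 1 (a ord_max) _ _ lsum (lF ord_max)).
move=> x ihx; rewrite big_ord_recr/= mul1r ihx => <-.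
by congr (S _ x); apply/funext => y; rewrite big_ord_recr/= mul1r.
Qed.

(** The upper bound is int_E S f <= int S f = int f. Since S f >= 0 holds only almost everywhere,
    the estimates are run on |S f|. *)
Lemma op_dominated_functional (E : set T) : measurable E ->
  dominated_functional mu (fun f => \int[mu]_(x in E) S f x).
Proof.
move=> mE; split => [a b f g lf lg|f lf f0].
  have [[_ _ lin _] _ _] := hS.
  have lSf := op_L1fun lf; have lSg := op_L1fun lg.
  rewrite (ae_eq_Rintegral mE _ _ (lin a b _ _ lf lg)); last 2 first.
  - exact: (L1fun_measurable (op_L1fun (L1fun_lin a b lf lg))).
  - exact: (L1fun_measurable (L1fun_lin a b lSf lSg)).
  rewrite RintegralD//; [|exact: (integrableZl mE a (L1fun_integrableS mE lSf))
                         |exact: (integrableZl mE b (L1fun_integrableS mE lSg))].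
  by rewrite !RintegralZl//; exact: L1fun_integrableS.
have lSf := op_L1fun lf; have mSf := L1fun_measurable lSf.
have lnSf := L1fun_norm lSf; have mnSf := L1fun_measurable lnSf.
have aeS := op_ge0 lf f0.
rewrite -op_Rintegral// -(ae_eq_Rintegral mE mnSf mSf aeS).
rewrite -(ae_eq_Rintegral measurableT mnSf mSf aeS) Rintegral_ge0//=.
rewrite -lee_fin !EFin_Rintegral//.
by apply: ge0_subset_integral => //; exact/measurable_EFinP.
Qed.

(** The bound on the adjoint in the definition of [S] concerns any function representing it; here
    the Riesz representation of f |-> int_E S f supplies one with values in [0, 1]. *)
Lemma adjoint_indicator_exists (E : set T) : sigma_finite setT mu ->
  measurable E -> exists h : T -> R,
  [/\ adjoint_of_indicator mu S E h, forall x, 0 <= h x <= 1 &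
  forall f, L1fun mu f ->
    \int[mu]_(x in E) S f x = \int[mu]_x (h x * f x)].
Proof.
move=> hmu mE.
(* A partition adapted to no function at all already yields a strictly positive integrable weight,
   [e] composed with [c]. *)
have [c [e [mc e0 _ ie _]]] := @fine_partition _ _ _ mu 0 (fun _ _ => 0) 1 hmu
  (fun _ => measurable_cst _) ltr01.
have lw : L1fun mu (fun x => e (c x)).
  apply/integrableP; split; first exact/measurable_EFinP/measurable_fun_fiberwise.
  apply: (le_lt_trans _ (ltry 1)); apply: le_trans ie.
  by under eq_integral do rewrite /= ger0_norm ?ltW//.
have [h [mh h01 hE]] := riesz hmu (op_dominated_functional mE) (fun x => e0 (c x)) lw.
have lh f : L1fun mu f -> L1fun mu (fun x => h x * f x).
  apply: (@L1fun_boundedM _ _ _ _ _ _ 1) => // x.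
  by case/andP: (h01 x) => h0 h1; rewrite ger0_norm.
exists h; split => //; split => //.
  by exists 1; apply: aeW => x; case/andP: (h01 x) => h0 h1; rewrite ger0_norm.
move=> f lf; have : (\int[mu]_(x in E) S f x)%:E = (\int[mu]_x (h x * f x))%:E.
  by rewrite hE.
rewrite -Rintegral_indicM.
rewrite (EFin_Rintegral _ (lh _ lf))// EFin_Rintegral//.
by apply: L1fun_indicM => //; exact: op_L1fun.
Qed.

End operator.

(** * The averaged kernel *)

Section kernel.
Context {d : measure_display} {T : measurableType d} {R : realType}.
Variable mu : {measure set T -> \bar R}.
Variable S : (T -> R) -> (T -> R).
Hypothesis hS : semi_doubly_stochastic_op mu S.
Variable c : T -> nat.
Hypothesis mc : measurable_fun setT c.
Hypothesis coo : forall j, (mu (c @^-1` [set j]) < +oo)%E.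
Variable h : nat -> T -> R.
Hypothesis adj_h : forall l, adjoint_of_indicator mu S (c @^-1` [set l]) (h l).
Hypothesis h01 : forall l x, 0 <= h l x <= 1.
Hypothesis hE : forall l f, L1fun mu f ->
  \int[mu]_(x in c @^-1` [set l]) S f x = \int[mu]_x (h l x * f x).

Local Notation P j := (c @^-1` [set j]).
Local Notation m j := (fine (mu (P j))).

Let mP j : measurable (P j) := measurable_fiber mc j.
Let mh l : measurable_fun setT (h l).
Proof. by case: (adj_h l). Qed.
Let h_ge0 l x : 0 <= h l x. Proof. by case/andP: (h01 l x). Qed.
Let h_le1 l x : h l x <= 1. Proof. by case/andP: (h01 l x). Qed.
Let h_norm l x : `|h l x| <= 1. Proof. by rewrite ger0_norm. Qed.

Lemma fiber_measureE j : mu (P j) = (m j)%:E.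
Proof. by rewrite fineK// ge0_fin_numE. Qed.
Let m_ge0 j : 0 <= m j. Proof. exact: fine_ge0. Qed.

Lemma integral_adjoint_le l : (\int[mu]_x (h l x)%:E <= (m l)%:E)%E.
Proof.
rewrite -fiber_measureE; have [_ _ +] := hS.
by move=> /(_ _ (mP l) (coo l) _ (adj_h l)).
Qed.

Lemma adjoint_L1fun l : L1fun mu (h l).
Proof.
apply/integrableP; split; first exact/measurable_EFinP.
under eq_integral do rewrite /= ger0_norm//.
exact: le_lt_trans (integral_adjoint_le l) (ltry _).
Qed.

(** By [hE] the numerator is the integral of S 1_(P j) over P l; written with [h l] it serves rows
    and columns alike. The index l is the cell of the output variable, j that of the integration
    variable. *)
Definition cell_kernel (l j : nat) : R :=
  (\int[mu]_(x in P j) h l x) / (m j * m l).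
Local Notation k := cell_kernel.

Lemma cell_kernel_ge0 l j : 0 <= k l j.
Proof. by rewrite /k divr_ge0 ?mulr_ge0// Rintegral_ge0. Qed.

Lemma integral_adjoint_fiber_le l j : \int[mu]_(x in P j) h l x <= m j.
Proof.
rewrite -[leRHS]mul1r -Rintegral_cst//; apply: le_Rintegral => //.
- exact/L1fun_integrableS/adjoint_L1fun.
- apply: measurable_bounded_integrable => //.
  by exists 1; split => // M M1 x _ /=; rewrite normr1 ltW.
Qed.

(** The average of [h l] over a cell is at most 1. The bound makes the products of the kernel with
    integrable functions integrable; both sides are 0 when m l = 0. *)
Lemma cell_kernel_norm_le l j : `|k l j| <= (m l)^-1.
Proof.
rewrite ger0_norm ?cell_kernel_ge0// /k invfM mulrA.
rewrite ler_piMl ?invr_ge0//.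
have [->|mj0] := eqVneq (m j) 0; first by rewrite invr0 mulr0.
have mj : 0 < m j by rewrite lt0r mj0/=.
by rewrite ler_pdivrMr// mul1r integral_adjoint_fiber_le.
Qed.

(* If a cell is null, [k l j] is [0] by division by zero, and the right-hand side
   vanishes as well. *)
Lemma cell_kernelE l j : m l * k l j * m j = \int[mu]_(x in P j) h l x.
Proof.
have [mj0|mj0] := eqVneq (m j) 0.
  rewrite mj0 mulr0; apply/esym/eqP; rewrite eq_le Rintegral_ge0// andbT.
  by rewrite -mj0 integral_adjoint_fiber_le.
have [ml0|ml0] := eqVneq (m l) 0; last by rewrite /k; field; rewrite mj0 ml0.
rewrite ml0 !mul0r; apply/esym/eqP; rewrite eq_le Rintegral_ge0// andbT.
rewrite -lee_fin EFin_Rintegral//; last exact: adjoint_L1fun.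
apply: (@le_trans _ _ (\int[mu]_x (h l x)%:E)%E); last by rewrite -ml0 integral_adjoint_le.
apply: ge0_subset_integral => //; first exact/measurable_EFinP.
by move=> x _; rewrite lee_fin.
Qed.

(** On P j the factor [a (c y)] is constant, so only the integral of [h l] over P j matters, and
    [cell_kernelE] preserves it. *)
Lemma cell_kernel_fiber (a : nat -> R) l j :
  (\int[mu]_(y in P j) (m l * k l (c y) * a (c y))%:E =
   \int[mu]_(y in P j) (h l y * a (c y))%:E)%E.
Proof.
transitivity (\int[mu]_(y in P j) (m l * k l j * a j)%:E)%E.
  by apply: eq_integral => y; rewrite inE /= => ->.
rewrite integral_cst//= [mu (P j)]fiber_measureE -EFinM mulrAC cell_kernelE.
rewrite -RintegralZr//; last exact/L1fun_integrableS/adjoint_L1fun.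
rewrite EFin_Rintegral//; last first.
  have := L1fun_lin (a j) 0 (adjoint_L1fun l) (L1fun0 mu).
  by apply: eq_L1fun => x; rewrite mulr0 addr0 mulrC.
by apply: eq_integral => y; rewrite inE /= => ->.
Qed.

(** Extended-real version, where [a] composed with [c] may fail to be integrable; with a = 1 it
    yields the row condition. *)
Lemma cell_kernel_ge0_integral (a : nat -> R) l : (forall j, 0 <= a j) ->
  (\int[mu]_y (m l * k l (c y) * a (c y))%:E =
   \int[mu]_y (h l y * a (c y))%:E)%E.
Proof.
move=> a0.
have mka := measurable_fun_fiberwise mc (fun j => m l * k l j * a j).
have mha : measurable_fun setT (fun y => h l y * a (c y)).
  by apply: measurable_funM => //; exact: measurable_fun_fiberwise.
rewrite (ge0_integral_fibers mu mc); [|exact/measurable_EFinP|]; last first.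
  move=> y; rewrite lee_fin; apply: mulr_ge0 => //; apply: mulr_ge0 => //.
  exact: cell_kernel_ge0.
rewrite (ge0_integral_fibers mu mc); [|exact/measurable_EFinP|]; last first.
  by move=> y; rewrite lee_fin mulr_ge0.
by apply: eq_eseriesr => j _; exact: cell_kernel_fiber.
Qed.

(** Version for signed integrable functions, which serves the error estimate. *)
Lemma cell_kernel_integral (a : nat -> R) l : L1fun mu (fun y => a (c y)) ->
  \int[mu]_y (m l * k l (c y) * a (c y)) = \int[mu]_y (h l y * a (c y)).
Proof.
move=> la; have lh := L1fun_boundedM (mh l) (h_norm l) la.
have lk : L1fun mu (fun y => m l * k l (c y) * a (c y)).
  (* This bound is 1, or 0 when m l = 0. *)
  apply: (@L1fun_boundedM _ _ _ _ _ _ (m l * (m l)^-1)) la.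
    exact: (measurable_fun_fiberwise mc (fun j => m l * k l j)).
  by move=> x; rewrite normrM ger0_norm// ler_wpM2l// cell_kernel_norm_le.
rewrite /Rintegral (integral_fibers mc lk) (integral_fibers mc lh); congr fine.
by apply: eq_eseriesr => j _; exact: cell_kernel_fiber.
Qed.

(** * Measurability and marginals of the averaged kernel *)

(** The kernel factors through a map with countably many values whose nonempty fibers are the
    rectangles P l x P j. *)
Lemma measurable_cell_kernel :
  measurable_fun setT (fun p : T * T => k (c p.1) (c p.2)).
Proof.
pose c2 (p : T * T) := pickle (c p.1, c p.2).
have mc2 : measurable_fun setT c2.
  apply: measurable_fun_fibers => j.
  have [->|/set0P[p0 /= <-]] := eqVneq (c2 @^-1` [set j]) set0 => //.
  rewrite (_ : _ @^-1` _ = P (c p0.1) `*` P (c p0.2)).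
    exact: measurableX.
  apply/seteqP; split => [p /= /(pcan_inj pickleK)[-> ->]//|p [/= p1 p2]].
  by rewrite /c2 p1 p2.
have := measurable_fun_fiberwise mc2
  (fun n => if @unpickle (nat * nat)%type n is Some q then k q.1 q.2 else 0).
by congr (measurable_fun _ _); apply/funext => p; rewrite /c2 pickleK.
Qed.

Lemma cell_kernel_row l : (\int[mu]_y (k l (c y))%:E <= 1)%E.
Proof.
have [ml0|ml0] := eqVneq (m l) 0.
  rewrite integral0_eq// => y _.
  by rewrite /k ml0 mulr0 invr0 mulr0.
have ml : 0 < m l by rewrite lt0r ml0/=.
have := integral_adjoint_le l.
rewrite (_ : (\int[mu]_x (h l x)%:E = \int[mu]_x (m l * k l (c x) * 1)%:E)%E); last first.
  rewrite (@cell_kernel_ge0_integral (fun=> 1) l)//.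
  by under [RHS]eq_integral do rewrite mulr1.
under eq_integral do rewrite mulr1 EFinM.
rewrite ge0_integralZl//.
- by rewrite -[leRHS]mule1 lee_pmul2l.
- exact/measurable_EFinP/(measurable_fun_fiberwise mc (k l)).
- by move=> x _; rewrite lee_fin cell_kernel_ge0.
Qed.

(** On P l the kernel integrates to (m j)^-1 times the integral of S 1_(P j) over P l. Summing over
    l, mass preservation gives (m j)^-1 m j = 1. *)
Lemma cell_kernel_col j : m j != 0 -> (\int[mu]_x (k (c x) j)%:E = 1)%E.
Proof.
move=> mj0; have l1 : L1fun mu (\1_(P j) : T -> R).
  apply/integrableP; split; first exact/measurable_EFinP/measurable_indic.
  by under eq_integral do rewrite /= ger0_norm//; rewrite integral_indic// setIT.
have lS1 := op_L1fun hS l1.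
rewrite (ge0_integral_fibers mu mc); last 2 first.
- exact/measurable_EFinP/(measurable_fun_fiberwise mc (k ^~ j)).
- by move=> x; rewrite lee_fin cell_kernel_ge0.
have lS1m : L1fun mu (fun x => (m j)^-1 * S \1_(P j) x).
  have := L1fun_lin (m j)^-1 0 lS1 (L1fun0 mu).
  by apply: eq_L1fun => x; rewrite mulr0 addr0.
transitivity (\int[mu]_x ((m j)^-1 * S \1_(P j) x)%:E)%E.
  rewrite (integral_fibers mc lS1m); apply: eq_eseriesr => l _.
  transitivity (\int[mu]_(x in P l) (k l j)%:E)%E.
    by apply: eq_integral => x; rewrite inE /= => ->.
  rewrite integral_cst//= [mu (P l)]fiber_measureE -EFinM.
  rewrite -EFin_Rintegral// RintegralZl//; last first.
    exact: L1fun_integrableS.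
  congr EFin; rewrite hE//.
  under eq_Rintegral do rewrite mulrC.
  by rewrite Rintegral_indicM -cell_kernelE; field.
rewrite -EFin_Rintegral// RintegralZl// (op_Rintegral hS)//.
by rewrite /Rintegral integral_indic// setIT mulVf.
Qed.

Lemma cell_kernel_semi_doubly_stochastic :
  semi_doubly_stochastic_kernel mu (fun x y => k (c x) (c y)).
Proof.
split.
- exact: measurable_cell_kernel.
- by move=> x y; exact: cell_kernel_ge0.
- have : {ae mu, forall y j, c y = j -> (\int[mu]_x (k (c x) j)%:E = 1)%E}.
    apply: ae_foralln => j.
    have [mj0|mj0] := eqVneq (m j) 0; last first.
      by apply: aeW => y _; exact: cell_kernel_col.
    (* The column identity may fail on null cells, but each of them is itself a null exceptional
       set, and there are countably many. *)
    exists (P j); split => //; first by rewrite fiber_measureE mj0.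
    by move=> y /= /not_implyP[].
  by apply: filterS => y; exact.
- by apply: aeW => x; exact: cell_kernel_row.
Qed.

(* [f - a o c] is controlled by [e o c]; the part [a o c] cancels exactly, since
   [m l * k l (c y)] is the cell average of [h l]. *)
Lemma cell_kernel_fiber_error (f s : T -> R) (e a b : nat -> R) l x :
  L1fun mu f -> L1fun mu s -> {ae mu, forall x, S f x = s x} ->
  L1fun mu (fun x => e (c x)) -> m l != 0 -> c x = l ->
  (forall x, `|f x - a (c x)| <= e (c x)) ->
  (forall x, `|s x - b (c x)| <= e (c x)) ->
  m l * `|integral_op mu (fun x y => k (c x) (c y)) f x - s x| <=
  2 * \int[mu]_(y in P l) S (fun x => e (c x)) y + 2 * (m l * e l).
Proof.
move=> lf ls Sfs le ml0 cx fa sb.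
have ml : 0 < m l by rewrite lt0r ml0/=.
have mf := L1fun_measurable lf; have ms := L1fun_measurable ls.
have la : L1fun mu (fun x => a (c x)).
  apply: (@L1fun_le _ _ _ _ _ (fun x => 1 * `|f x| + 1 * e (c x))).
  - exact: measurable_fun_fiberwise.
  - move=> y; rewrite !mul1r -[a (c y)](subKr (f y)).
    by rewrite (le_trans (ler_normB _ _))// lerD2l.
  - exact/L1fun_lin/le/L1fun_norm.
have kb y : `|m l * k l (c y)| <= m l * (m l)^-1.
  by rewrite normrM ger0_norm// ler_wpM2l// cell_kernel_norm_le.
have mk : measurable_fun setT (fun y => m l * k l (c y)).
  exact: (measurable_fun_fiberwise mc (fun j => m l * k l j)).
have lk g : L1fun mu g -> L1fun mu (fun y => m l * k l (c y) * g y).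
  exact: L1fun_boundedM.
have lh g : L1fun mu g -> L1fun mu (fun y => h l y * g y).
  exact: L1fun_boundedM.
pose q := integral_op mu (fun x y => k (c x) (c y)) f x.
have qE : m l * q = \int[mu]_y (m l * k l (c y) * f y).
  rewrite /q /integral_op cx -RintegralZl//; last first.
    apply: L1fun_boundedM lf; first exact: (measurable_fun_fiberwise mc (k l)).
    by move=> y; exact: cell_kernel_norm_le.
  by apply: eq_Rintegral => y _; rewrite mulrA.
have AE : \int[mu]_(y in P l) s y = \int[mu]_y (h l y * f y).
  rewrite -hE//; apply/esym/ae_eq_Rintegral => //.
  exact/L1fun_measurable/(op_L1fun hS lf).
(* Both integrals agree on [a] composed with [c], so f may be replaced by f - a o c. Each is then at
   most int h_l (e o c), the integral of S (e o c) over P l; hence the factor 2. *)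
have key : `|m l * q - \int[mu]_(y in P l) s y| <=
    2 * \int[mu]_(y in P l) S (fun x => e (c x)) y.
  have lfa := L1fun_sub lf la.
  have -> : m l * q - \int[mu]_(y in P l) s y =
    \int[mu]_y (m l * k l (c y) * (f y - a (c y))) -
    \int[mu]_y (h l y * (f y - a (c y))).
    rewrite qE AE; under [X in _ = X - _]eq_Rintegral do rewrite mulrBr.
    under [X in _ = _ - X]eq_Rintegral do rewrite mulrBr.
    rewrite RintegralB ?lk// RintegralB ?lh// cell_kernel_integral//; lra.
  apply: (le_trans (ler_normB _ _)).
  have kfa : `|\int[mu]_y (m l * k l (c y) * (f y - a (c y)))| <=
      \int[mu]_y (m l * k l (c y) * e (c y)).
    apply: (le_trans (le_normr_Rintegral _ _)) => //; first exact: lk.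
    apply: le_Rintegral => //; [exact/L1fun_norm/lk|exact: lk|].
    move=> y _; rewrite normrM ger0_norm ?ler_wpM2l//.
      by apply: mulr_ge0 => //; exact: cell_kernel_ge0.
    by apply: mulr_ge0 => //; exact: cell_kernel_ge0.
  have hfa : `|\int[mu]_y (h l y * (f y - a (c y)))| <=
      \int[mu]_y (h l y * e (c y)).
    apply: (le_trans (le_normr_Rintegral _ _)) => //; first exact: lh.
    apply: le_Rintegral => //; [exact/L1fun_norm/lh|exact: lh|].
    by move=> y _; rewrite normrM ger0_norm ?ler_wpM2l.
  rewrite cell_kernel_integral// in kfa.
  by rewrite hE//; lra.
have avg : `|\int[mu]_(y in P l) s y - m l * b l| <= m l * e l.
  have lb : mu.-integrable (P l) (EFin \o (fun=> b l)).
    apply: measurable_bounded_integrable => //.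
    by exists `|b l|; split; [exact: num_real|move=> M M1 y _ /=; exact: ltW].
  have lbe : mu.-integrable (P l) (EFin \o (fun=> e l)).
    apply: measurable_bounded_integrable => //.
    by exists `|e l|; split; [exact: num_real|move=> M M1 y _ /=; exact: ltW].
  have lsP := L1fun_integrableS (mP l) ls.
  rewrite [m l * b l]mulrC [m l * e l]mulrC -!Rintegral_cst// -RintegralB//.
  have lsb : mu.-integrable (P l) (EFin \o (fun y => s y - b l)).
    exact: (integrableB (mP l) lsP lb).
  apply: (le_trans (le_normr_Rintegral _ _)) => //.
  apply: le_Rintegral => //; first exact: integrable_norm.
  by move=> y /= <-.
have sx : `|m l * s x - m l * b l| <= m l * e l.
  by rewrite -mulrBr normrM ger0_norm// ler_wpM2l// -cx.
(* The difference m l (q - s x) is split at the integral of s over P l and at m l b l; the last two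
   differences cost m l e l each. *)
rewrite -/q; rewrite -[X in X * _](ger0_norm (m_ge0 l)) -normrM mulrBr.
move: key avg sx; rewrite !ler_norml => /andP[? ?] /andP[? ?] /andP[? ?].
by apply/andP; split; lra.
Qed.

(** Summing the fiber errors gives 2 int S (e o c) + 2 int e o c, which is 4 int e o c by mass
    preservation. The function [s] is a version of S f for which the approximation holds
    pointwise. *)
Lemma cell_kernel_error (f s : T -> R) (e a b : nat -> R) :
  L1fun mu f -> L1fun mu s -> {ae mu, forall x, S f x = s x} ->
  L1fun mu (fun x => e (c x)) -> (forall j, 0 <= e j) ->
  (forall x, `|f x - a (c x)| <= e (c x)) ->
  (forall x, `|s x - b (c x)| <= e (c x)) ->
  (\int[mu]_x (`|integral_op mu (fun x y => k (c x) (c y)) f x - S f x|)%:E <=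
   (4 * \int[mu]_x e (c x))%:E)%E.
Proof.
move=> lf ls Sfs le e0 fa sb.
pose I := integral_op mu (fun x y => k (c x) (c y)) f.
have mI : measurable_fun setT I.
  exact: (measurable_fun_fiberwise mc (fun l => \int[mu]_y (k l (c y) * f y))).
have mSf := L1fun_measurable (op_L1fun hS lf); have ms := L1fun_measurable ls.
have mIs : measurable_fun setT (fun x => `|I x - s x|).
  by apply: measurableT_comp => //; exact: measurable_funB.
have lSe := op_L1fun hS le.
pose E x := 2 * `|S (fun x => e (c x)) x| + 2 * e (c x).
have lE : L1fun mu E by apply/L1fun_lin/le/L1fun_norm.
have E0 x : 0 <= E x by rewrite addr_ge0// mulr_ge0.
have -> : 4 * \int[mu]_x e (c x) = \int[mu]_x E x.
  rewrite RintegralD//; last 2 first.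
  - exact: (integrableZl measurableT 2 (L1fun_norm lSe)).
  - exact: (integrableZl measurableT 2 le).
  rewrite !RintegralZl//; last exact: L1fun_norm.
  rewrite (ae_eq_Rintegral measurableT _ _ (op_ge0 hS le _))//.
  - by rewrite (op_Rintegral hS)//; lra.
  - exact/L1fun_measurable/(L1fun_norm lSe).
  - exact: L1fun_measurable lSe.
rewrite EFin_Rintegral// (ae_eq_integral (fun x => (`|I x - s x|)%:E))//; last 3 first.
- apply/measurable_EFinP; apply: measurableT_comp => //; exact: measurable_funB.
- exact/measurable_EFinP.
- by apply: filterS Sfs => x /= -> _.
rewrite (ge0_integral_fibers mu mc); [|exact/measurable_EFinP|by move=> x; rewrite lee_fin].
rewrite (ge0_integral_fibers mu mc);
  [|exact/measurable_EFinP/L1fun_measurable/lE|by move=> x; rewrite lee_fin].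
apply: lee_nneseries => [l _ _|l _]; first exact: integral_ge0.
have [ml0|ml0] := eqVneq (m l) 0.
  rewrite null_set_integral//; first by apply: integral_ge0 => x _; rewrite lee_fin.
    exact/measurable_EFinP/(measurable_funS measurableT).
  by rewrite fiber_measureE ml0.
have ml : 0 < m l by rewrite lt0r ml0/=.
pose B := 2 * \int[mu]_(y in P l) S (fun x => e (c x)) y + 2 * (m l * e l).
(* The bound is uniform on P l, so integrating it over the cell multiplies by m l and cancels the
   inverse. *)
have le1 x : P l x -> `|I x - s x| <= (m l)^-1 * B.
  move=> cx; rewrite ler_pdivlMl//.
  exact: (cell_kernel_fiber_error lf ls Sfs le ml0 cx fa sb).
apply: (@le_trans _ _ (\int[mu]_(x in P l) ((m l)^-1 * B)%:E)%E).
  apply: ge0_le_integral => //.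
  exact/measurable_EFinP/(measurable_funS measurableT).
rewrite integral_cst//= [mu (P l)]fiber_measureE -EFinM mulrAC mulVf// mul1r.
rewrite -EFin_Rintegral// lee_fin RintegralD//; last 2 first.
- exact: (integrableZl (mP l) 2 (L1fun_integrableS (mP l) (L1fun_norm lSe))).
- exact: (integrableZl (mP l) 2 (L1fun_integrableS (mP l) le)).
rewrite !RintegralZl//; [|exact: (L1fun_integrableS (mP l) (L1fun_norm lSe))|
  exact: (L1fun_integrableS (mP l) le)].
rewrite /B lerD ?ler_wpM2l//.
  apply: le_trans (ler_norm _) _.
  by apply: le_normr_Rintegral => //; exact: L1fun_integrableS.
rewrite [leRHS](@eq_Rintegral _ _ _ _ _ (fun=> e l)); last first.
  by move=> x; rewrite inE /= => ->.
by rewrite Rintegral_cst// mulrC.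
Qed.

End kernel.

(** * Approximation on the span of finitely many functions *)

(** The kernel depends only on the generators and on [eps], so one kernel serves all coefficient
    vectors, with an error proportional to the sum of the |a_i|. *)
Lemma approximating_kernel (d : measure_display) (T : measurableType d) (R : realType)
  (mu : {measure set T -> \bar R}) (S : (T -> R) -> (T -> R)) (m : nat)
  (g : 'I_m -> T -> R) (eps : R) :
  sigma_finite setT mu -> semi_doubly_stochastic_op mu S ->
  (forall i, L1fun mu (g i)) -> 0 < eps ->
  exists K : T -> T -> R, semi_doubly_stochastic_kernel mu K /\
    forall (a : 'I_m -> R) (f : T -> R),
      f = (fun x => \sum_(i < m) a i * g i x) ->
      (\int[mu]_x (`|integral_op mu K f x - S f x|)%:E <=
       (4 * (\sum_(i < m) `|a i|) * eps)%:E)%E.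
Proof.
move=> hmu hS lg eps0.
have lSg i := op_L1fun hS (lg i).
(* The family lists the g_i and then the S g_i, so that a single partition is fine for both. *)
pose u (i : 'I_(m + m)) := match fintype.split i with inl i => g i | inr i => S (g i) end.
have mu_ i : measurable_fun setT (u i).
  by rewrite /u; case: (fintype.split i) => j; exact: L1fun_measurable.
have [c [e [mc e0 coo ie ue]]] := fine_partition hmu mu_ eps0.
have /choice[al gal] i : exists b : nat -> R,
    forall x, `|g i x - b (c x)| <= e (c x).
  by have [b] := ue (lshift m i); rewrite /u (unsplitK (inl i)) => ?; exists b.
have /choice[be gbe] i : exists b : nat -> R,
    forall x, `|S (g i) x - b (c x)| <= e (c x).
  by have [b] := ue (rshift m i); rewrite /u (unsplitK (inr i)) => ?; exists b.
have /choice[h hP] l := adjoint_indicator_exists hS hmu (measurable_fiber mc l).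
have adj_h l : adjoint_of_indicator mu S (c @^-1` [set l]) (h l) by case: (hP l).
have h01 l x : 0 <= h l x <= 1 by case: (hP l).
have hE l f : L1fun mu f ->
    \int[mu]_(x in c @^-1` [set l]) S f x = \int[mu]_x (h l x * f x).
  by case: (hP l) => _ _; apply.
exists (fun x y => cell_kernel mu c h (c x) (c y)); split.
  exact: (cell_kernel_semi_doubly_stochastic hS mc coo adj_h h01 hE).
move=> a f fE.
have le : L1fun mu (fun x => e (c x)).
  apply/integrableP; split; first exact/measurable_EFinP/measurable_fun_fiberwise.
  apply: le_lt_trans (ltry eps); apply: le_trans ie.
  by under eq_integral do rewrite /= ger0_norm ?ltW//.
pose A := \sum_(i < m) `|a i|.
have A0 : 0 <= A by exact: sumr_ge0.
have lAe : L1fun mu (fun x => A * e (c x)).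
  by have := L1fun_lin A 0 le le; apply: eq_L1fun => x; rewrite mul0r addr0.
have comb (v : 'I_m -> T -> R) (w : 'I_m -> nat -> R) x :
    (forall i x, `|v i x - w i (c x)| <= e (c x)) ->
    `|\sum_(i < m) a i * v i x - \sum_(i < m) a i * w i (c x)| <= A * e (c x).
  move=> vw; rewrite -sumrB (le_trans (ler_norm_sum _ _ _))// mulr_suml ler_sum//.
  by move=> i _; rewrite -mulrBr normrM ler_wpM2l.
(* Linear combinations inherit the cell-wise approximation with [e] scaled by [A]; the version of S
   f used is the sum of the a_i S (g_i), equal to it almost everywhere. *)
apply: (le_trans (@cell_kernel_error _ _ _ mu S hS c mc coo h adj_h h01 hE f
  (fun x => \sum_(i < m) a i * S (g i) x) (fun j => A * e j)
  (fun j => \sum_(i < m) a i * al i j) (fun j => \sum_(i < m) a i * be i j)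
  _ _ _ lAe _ _ _)).
- by rewrite fE; exact: L1fun_sum.
- exact: L1fun_sum.
- by rewrite fE; exact: op_sum.
- by move=> j; rewrite mulr_ge0// ltW.
- by move=> x; rewrite fE; exact: comb.
- by move=> x; exact: (comb (fun i => S (g i))).
rewrite RintegralZl// lee_fin -mulrA ler_wpM2l// ler_wpM2l//.
by rewrite -lee_fin EFin_Rintegral.
Qed.

Unset Implicit Arguments.
Set Strict Implicit.

(* F = span of finitely many L^1 functions g_0, ..., g_(m-1) *)
Theorem theorem4p11 (d : measure_display) (T : measurableType d) (R : realType)
  (mu : {measure set T -> \bar R}) (hmu : sigma_finite setT mu)
  (S : (T -> R) -> (T -> R)) (hS : semi_doubly_stochastic_op mu S)
  (m : nat) (g : 'I_m -> T -> R) (hg : forall i, L1fun mu (g i)) :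
  exists K : nat -> T -> T -> R,
    (forall n, semi_doubly_stochastic_kernel mu (K n)) /\
    forall c : 'I_m -> R,
      let f := fun x => \sum_(i < m) c i * g i x in
      (fun n => \int[mu]_x (`| integral_op mu (K n) f x - S f x |)%:E)%E
        @ \oo --> 0%E.
Proof.
(* With eps = 1 / (n + 1), the n-th kernel is chosen before the coefficients, so one sequence works
   on the whole span. *)
have /choice[K KP] (n : nat) :=
  approximating_kernel hmu hS hg (ltac:(by []) : 0 < n.+1%:R^-1 :> R).
exists K; split => [n|a f]; first by case: (KP n).
pose A : R := 4 * \sum_(i < m) `|a i|.
apply: (@squeeze_cvge _ _ _ _ (fun=> 0%E) _ (fun n => (A * n.+1%:R^-1)%:E)).
- apply: nearW => n; have [_ /(_ a f erefl) ->] := KP n.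
  by rewrite andbT integral_ge0.
- exact: cvg_cst.
- apply: cvg_EFin; first exact: nearW.
  rewrite -[0](mulr0 A); apply: cvgM; first exact: cvg_cst.
  exact: cvg_harmonic.
Qed.
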